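(* Consider the composite problem, the Stochastic Decoupling Method and the gradient-estimator condition described in the context. Assume $f$ is $L$-smooth and $\mu$-strongly convex, and $g_1,\dots,g_m,R$ are proper, closed and convex. Suppose that $v^t$ is generated by a method that satisfies the gradient-estimator condition with constants $\eta_0>0$, $\omega>0$ and a nonnegative sequence $\{\mathcal M^t\}_{t\ge0}$, and that $\eta\le\eta_0$. Then for every $t\ge1$, $$\mathbb{E}\, D_f(\overline x^t,x^* )\le \frac{1}{\omega\eta t}\mathcal L^0,$$ where $\overline x^t:=\frac1t\sum_{k=0}^{t-1}x^k$ and $\mathcal L^0:=\|x^0-x^*\|^2+\mathcal M^0+\sum_{k=1}^m\eta_k^2\|y_k^0-y_k^*\|^2$.
   Context: Problem: $\min_{x\in\mathbb{R}^d}F(x):=f(x)+\frac1m\sum_{j=1}^m g_j(x)+R(x)$, where $f:\mathbb{R}^d\to\mathbb{R}$ is differentiable and convex, and $g_1,\dots,g_m,R:\mathbb{R}^d\to\mathbb{R}\cup\{+\infty\}$ are proper closed convex functions; the set of minimizers of $F$ is nonempty. $f$ is $L$-smooth if $f(x)\le f(y)+\langle\nabla f(y),x-y\rangle+\frac L2\|x-y\|^2$ for all $x,y$, and $\mu$-strongly convex ($\mu\ge0$) if $f(x)\ge f(y)+\langle\nabla f(y),x-y\rangle+\frac\mu2\|x-y\|^2$ for all $x,y$. Bregman divergence: $D_f(x,y):=f(x)-f(y)-\langle\nabla f(y),x-y\rangle$. Proximal operator: $\mathrm{prox}_{\eta h}(x):=\arg\min_u\{h(u)+\frac1{2\eta}\|u-x\|^2\}$.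 Standing optimality assumption: there exist a minimizer $x^*$ of $F$, vectors $y_j^*\in\partial g_j(x^* )$ ($j=1,\dots,m$) and $r^*\in\partial R(x^* )$ with $\nabla f(x^* )+\frac1m\sum_j y_j^*+r^*=0$; these are fixed, and $y^*:=\frac1m\sum_j y_j^*$. Stochastic Decoupling Method: stepsize $\eta>0$, probabilities $p_1,\dots,p_m>0$ summing to $1$, $\eta_j:=\eta/(mp_j)$. Start from deterministic $x^0,y_1^0,\dots,y_m^0\in\mathbb{R}^d$, $y^0:=\frac1m\sum_j y_j^0$. For $t=0,1,\dots$: a vector $v^t$ (an estimate of $\nabla f(x^t)$) is produced by a gradient estimator; $z^t=\mathrm{prox}_{\eta R}(x^t-\eta v^t-\eta y^t)$; an index $j$ is drawn with $\Pr(j=k)=p_k$, independently of the past; $x^{t+1}=\mathrm{prox}_{\eta_j g_j}(z^t+\eta_j y_j^t)$; $y_j^{t+1}=y_j^t+\frac1{\eta_j}(z^t-x^{t+1})$ and $y_k^{t+1}=y_k^t$ for $k\ne j$; $y^{t+1}=y^t+\frac1m(y_j^{t+1}-y_j^t)$. Gradient-estimator condition: with $w^t:=x^t-\eta v^t$ and $w^*:=x^*-\eta\nabla f(x^* )$, there are constants $\eta_0>0$, $\omega>0$ and a nonnegative sequence $\{\mathcal M^t\}$ such that for any $\eta\le\eta_0$ and all $t$: (a) if $f$ is convex, $\mathbb{E}\|w^t-w^*\|^2+\mathcal M^{t+1}\le\mathbb{E}\|x^t-x^*\|^2-\omega\eta\,\mathbb{E}D_f(x^t,x^* )+\mathcal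 M^t$; (b) if $f$ is $\mu$-strongly convex, either $\mathcal M^t=0$ for all $t$, or there is $\rho>0$ with $\mathbb{E}\|w^t-w^*\|^2+\mathcal M^{t+1}\le(1-\omega\eta\mu)\mathbb{E}\|x^t-x^*\|^2+(1-\rho)\mathcal M^t$. *)

(* Defs.v *)
From HB Require Import structures.
From mathcomp Require Import all_boot all_order all_algebra.
From mathcomp Require Import all_classical all_reals all_analysis.
Set Implicit Arguments.
Unset Strict Implicit.
Unset Printing Implicit Defensive.
Import Order.TTheory GRing.Theory Num.Theory.
Import numFieldNormedType.Exports.
Local Open Scope classical_set_scope.
Local Open Scope ring_scope.

Section Defs.
Variables (R : realType) (d : nat).
Local Notation V := 'rV[R]_d.

Definition dotv (u w : V) : R := \sum_(i < d) u ord0 i * w ord0 i.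
Definition sqnorm (u : V) : R := dotv u u.

Definition is_gradient (f : V -> R) (gf : V -> V) : Prop :=
  forall x : V, differentiable f x /\ forall h : V, 'd f x h = dotv (gf x) h.

Definition convex_real (f : V -> R) : Prop :=
  forall (x y : V) (l : R), 0 <= l <= 1 ->
    f (l *: x + (1 - l) *: y) <= l * f x + (1 - l) * f y.

Definition L_smooth (f : V -> R) (gf : V -> V) (L : R) : Prop :=
  forall x y : V, f x <= f y + dotv (gf y) (x - y) + L / 2 * sqnorm (x - y).

Definition strongly_convex (f : V -> R) (gf : V -> V) (mu : R) : Prop :=
  forall x y : V, f y + dotv (gf y) (x - y) + mu / 2 * sqnorm (x - y) <= f x.

Definition bregman (f : V -> R) (gf : V -> V) (x y : V) : R :=
  f x - f y - dotv (gf y) (x - y).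

Local Open Scope ereal_scope.

Definition proper_fun (h : V -> \bar R) : Prop :=
  (forall x, h x != -oo) /\ exists x, h x \is a fin_num.

Definition closed_fun (h : V -> \bar R) : Prop := lower_semicontinuous h.

Definition convex_efun (h : V -> \bar R) : Prop :=
  forall (x y : V) (l : R), (0 < l < 1)%R ->
    h (l *: x + (1 - l) *: y)%R <= l%:E * h x + (1 - l)%:E * h y.

Definition subgrad (h : V -> \bar R) (x y : V) : Prop :=
  forall u : V, h x + (dotv y (u - x)%R)%:E <= h u.

Definition is_prox (h : V -> \bar R) (eta : R) (x u : V) : Prop :=
  forall w : V, h u + ((2 * eta)^-1 * sqnorm (u - x)%R)%:E
                <= h w + ((2 * eta)^-1 * sqnorm (w - x)%R)%:E.

End Defs.

Section Defs2.
Variables (R : realType) (d m : nat).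
Local Notation V := 'rV[R]_d.
Local Open Scope ereal_scope.

Definition Fobj (f : V -> R) (g : 'I_m -> V -> \bar R) (Rr : V -> \bar R)
  (x : V) : \bar R :=
  (f x)%:E + (m%:R^-1)%:E * (\sum_(j < m) g j x) + Rr x.

Definition eta_j (eta : R) (p : 'I_m -> R) (j : 'I_m) : R :=
  (eta / (m%:R * p j))%R.

Definition ymean (y : 'I_m -> V) : V := (m%:R^-1 *: \sum_(j < m) y j)%R.
End Defs2.

Definition meas_wrt (R : realType) (T : Type) (G : set (set T)) (X : T -> R) :=
  forall B : set R, measurable B -> G (X @^-1` B).

(* Main.v *)
(* Write e = z^t - x*, s_k = y_k^t - y_k*.  The prox inequality for g_J gives
   |x^{t+1} - x*|^2 + eta_J^2 |y_J^{t+1} - y_J*|^2 <= |e + eta_J s_J|^2, and since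
   p_k eta_k = eta / m, averaging over J turns the cross terms into
   2 eta <e, y^t - y*>, which the prox inequality for R absorbs.  Hence
   E|x^{t+1} - x*|^2 + E Y^{t+1} <= E|w^t - w*|^2 + E Y^t with
   Y^t = sum_k eta_k^2 |y_k^t - y_k*|^2; condition (a) then makes
   E|x^t - x*|^2 + E Y^t + M^t decrease by omega eta E D_f(x^t, x* ), and the bound
   follows by telescoping and convexity of D_f(., x* ).  The iterates are adapted
   to the filtration because prox operators are nonexpansive. *)
Require Import Defs.
From HB Require Import structures.
From mathcomp Require Import all_boot all_order all_algebra.
From mathcomp Require Import all_classical all_reals all_analysis.
From mathcomp Require Import ring lra measurable_realfun.
Import Order.TTheory GRing.Theory Num.Theory.
Import numFieldNormedType.Exports.
Local Open Scope classical_set_scope.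
Local Open Scope ring_scope.

(** * Inner products, proximal inequalities and Bregman divergences *)

Section Deterministic.
Set Implicit Arguments.
Unset Strict Implicit.
Unset Printing Implicit Defensive.
Context {R : realType} {d : nat}.
Local Notation V := 'rV[R]_d.
Implicit Types (eta : R) (a b u w : V) (h : V -> \bar R).

Lemma dotvC u w : dotv u w = dotv w u.
Proof. by apply: eq_bigr => i _; rewrite mulrC. Qed.

Lemma dotvDl a u w : dotv (a + u) w = dotv a w + dotv u w.
Proof. by rewrite -big_split; apply: eq_bigr => i _; rewrite mxE mulrDl. Qed.

Lemma dotvZl c u w : dotv (c *: u) w = c * dotv u w.
Proof. by rewrite mulr_sumr; apply: eq_bigr => i _; rewrite mxE mulrA. Qed.

Lemma dotvNl u w : dotv (- u) w = - dotv u w.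
Proof. by rewrite -scaleN1r dotvZl mulN1r. Qed.

Lemma dotvDr a u w : dotv w (a + u) = dotv w a + dotv w u.
Proof. by rewrite dotvC dotvDl !(dotvC w). Qed.

Lemma dotvZr c u w : dotv w (c *: u) = c * dotv w u.
Proof. by rewrite dotvC dotvZl (dotvC w). Qed.

Lemma dotvNr u w : dotv w (- u) = - dotv w u.
Proof. by rewrite dotvC dotvNl (dotvC w). Qed.

Definition dotvE := (dotvDl, dotvDr, dotvNl, dotvNr, dotvZl, dotvZr).

Lemma dotv_sumr (I : finType) (F : I -> V) w :
  dotv w (\sum_i F i) = \sum_i dotv w (F i).
Proof.
apply: (big_ind2 (fun u c => dotv w u = c)) => //.
- by rewrite -(scale0r (0 : V)) dotvZr mul0r.
- by move=> u _ u' _ <- <-; rewrite dotvDr.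
Qed.

Lemma sqnorm_ge0 u : 0 <= sqnorm u.
Proof. by apply: sumr_ge0 => i _; rewrite -expr2 sqr_ge0. Qed.

Lemma sqr_coord_le_sqnorm u i : u ord0 i ^+ 2 <= sqnorm u.
Proof.
rewrite /sqnorm /dotv (bigD1 i)//= expr2 lerDl.
by apply: sumr_ge0 => j _; rewrite -expr2 sqr_ge0.
Qed.

(** A value [+oo] at [u] would force [h] to be [+oo] everywhere, against properness. *)
Lemma subgrad_fin_num h u a : proper_fun h -> subgrad h u a -> h u \is a fin_num.
Proof.
move=> [hNy [w hw]] hua; rewrite fin_numE hNy/=; apply/eqP => huy.
by have := hua w; rewrite huy /= addye// leye_eq; move/eqP => hwy; rewrite hwy in hw.
Qed.

Lemma subgrad_mono h u w a b : proper_fun h -> subgrad h u a -> subgrad h w b ->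
  0 <= dotv (a - b) (u - w).
Proof.
move=> ph ha hb.
have /fineK hu := subgrad_fin_num ph ha; have /fineK hw := subgrad_fin_num ph hb.
have := ha w; have := hb u; rewrite -hu -hw -!EFinD !lee_fin !dotvE; lra.
Qed.

(* Compare [u] with [u + l (w - u)], divide by [l] and let [l] tend to 0. *)
Lemma prox_subgrad h eta a u : 0 < eta -> proper_fun h -> convex_efun h ->
  is_prox h eta a u -> subgrad h u (eta^-1 *: (a - u)).
Proof.
move=> eta0 [hNy [c hc]] cvxh hu w.
have hufin : h u \is a fin_num.
  rewrite fin_numE hNy/=; apply/eqP => huy.
  by have := hu c; rewrite huy addye// -(fineK hc) -EFinD leye_eq.
have [->|hwy] := eqVneq (h w) +oo%E; first exact: leey.
have hwfin : h w \is a fin_num by rewrite fin_numE hNy.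
move: (fineK hufin) (fineK hwfin) => hu' hw'.
rewrite -hu' -hw' -EFinD lee_fin.
set q := sqnorm (w - u).
have q0 : 0 <= (2 * eta)^-1 * q.
  by rewrite mulr_ge0 ?sqnorm_ge0// invr_ge0 mulr_ge0// ltW.
suff H (l : R) : 0 < l < 1 ->
    fine (h u) + dotv (eta^-1 *: (a - u)) (w - u) <= fine (h w) + l * ((2 * eta)^-1 * q).
  apply/ler_addgt0Pr => e e0.
  (* The bound 1/2 keeps [l] below 1; the other makes the error at most [e], with [+ 1] guarding
     against a zero divisor when [w = u]. *)
  pose l := Num.min (2^-1) (e / ((2 * eta)^-1 * q + 1)).
  have q1 : 0 < (2 * eta)^-1 * q + 1 by lra.
  have l01 : 0 < l < 1.
    rewrite lt_min invr_gt0 divr_gt0//= ltr0n/=.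
    by rewrite gt_min invf_lt1 ?ltr1n.
  apply: (le_trans (H l l01)); rewrite lerD2l.
  apply: (@le_trans _ _ (l * ((2 * eta)^-1 * q + 1))).
    by rewrite ler_wpM2l; lra.
  by rewrite -ler_pdivlMr// ge_min lexx orbT.
move=> l01; have /andP[l0 l1] := l01.
have := le_trans (hu (l *: w + (1 - l) *: u)) (leeD2r _ (cvxh w u l l01)).
rewrite -hu' -hw' -!EFinM -!EFinD lee_fin /q /sqnorm !dotvE.
rewrite (dotvC u w) (dotvC a w) (dotvC a u) invfM.
set ww := dotv w w; set uu := dotv u u; set aa := dotv a a.
set wu := dotv w u; set wa := dotv w a; set ua := dotv u a.
set A := fine (h u); set B := fine (h w); set ie := eta^-1 => hl'.
rewrite -(ler_pM2l l0) /=; lra.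
Qed.

(** Monotonicity of the subdifferential, scaled by [eta]. With c = a - (w + eta b) and e = u - w it
    reads <c - e, e> >= 0, the form from which the three prox estimates below follow by expanding
    squares. *)
Lemma prox_dotv_ge0 h eta a b u w : 0 < eta -> proper_fun h -> convex_efun h ->
  is_prox h eta a u -> subgrad h w b ->
  0 <= dotv (a - (w + eta *: b) - (u - w)) (u - w).
Proof.
move=> eta0 ph ch hu hb.
have := subgrad_mono ph (prox_subgrad eta0 ph ch hu) hb.
rewrite -(pmulr_rge0 _ eta0) -dotvZl scalerBr scalerA divff ?gt_eqF// scale1r.
by rewrite !dotvE; lra.
Qed.

(** Taking the subgradient (b - w) / eta at [w] turns c into a - b; then |c|^2 = |e|^2 + |c - e|^2 +
    2 <c - e, e> >= |e|^2. *)
Lemma prox_nonexpansive h eta a b u w : 0 < eta -> proper_fun h -> convex_efun h ->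
  is_prox h eta a u -> is_prox h eta b w -> sqnorm (u - w) <= sqnorm (a - b).
Proof.
move=> eta0 ph ch hu hw.
have := prox_dotv_ge0 eta0 ph ch hu (prox_subgrad eta0 ph ch hw).
rewrite scalerA divff ?gt_eqF// scale1r addrCA subrr addr0.
have := sqnorm_ge0 (a - b - (u - w)).
rewrite /sqnorm !dotvE (dotvC u w) (dotvC b a) (dotvC u a) (dotvC u b).
rewrite (dotvC w a) (dotvC w b); lra.
Qed.

(** Same expansion of |c|^2, but |c - e|^2 is kept: for the step on [g j] it becomes the new dual
    error. *)
Lemma prox_step_le h eta a b u w : 0 < eta -> proper_fun h -> convex_efun h ->
  is_prox h eta a u -> subgrad h w b ->
  sqnorm (u - w) + sqnorm (a - u - eta *: b) <= sqnorm (a - (w + eta *: b)).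
Proof.
move=> eta0 ph ch hu hb; have := prox_dotv_ge0 eta0 ph ch hu hb.
rewrite -[a - u - _](_ : a - (w + eta *: b) - (u - w) = _); last first.
  by apply/rowP => i; rewrite !mxE; ring.
move: (a - (w + _)) (u - w) => c e.
rewrite /sqnorm !dotvE (dotvC e c); lra.
Qed.

(** Here [s] stands for the mean dual error, kept as an explicit cross term so that it can absorb
    the one produced by sampling. With c = q - r the prox inequality gives |e|^2 + eta <e, s> <= <c,
    e>, and 2 <c, e> <= |c|^2 + |e|^2. *)
Lemma prox_step_decoupled h eta q r s b u w : 0 < eta -> proper_fun h ->
  convex_efun h -> is_prox h eta (q - eta *: s) u -> subgrad h w b ->
  w + eta *: b = r ->
  sqnorm (u - w) + 2 * eta * dotv (u - w) s <= sqnorm (q - r).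
Proof.
move=> eta0 ph ch hu hb <-; have := prox_dotv_ge0 eta0 ph ch hu hb.
rewrite [q - eta *: s - _]addrAC.
move: (q - (w + _)) (u - w) => c e.
have := sqnorm_ge0 (c - e).
rewrite /sqnorm !dotvE (dotvC e c) (dotvC e s); lra.
Qed.

Lemma bregman_ge0 (f : V -> R) gf mu u w : 0 <= mu -> strongly_convex f gf mu ->
  0 <= bregman f gf u w.
Proof.
move=> mu0 /(_ u w); have := sqnorm_ge0 (u - w); rewrite /bregman => s0 ?.
have : 0 <= mu / 2 * sqnorm (u - w) by rewrite !mulr_ge0// ?invr_ge0.
lra.
Qed.

Lemma bregman_mean_le (f : V -> R) gf mu w (t : nat) (u : nat -> V) : (0 < t)%N ->
  0 <= mu -> strongly_convex f gf mu ->
  bregman f gf (t%:R^-1 *: \sum_(k < t) u k) w <=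
    t%:R^-1 * \sum_(k < t) bregman f gf (u k) w.
Proof.
move=> t0 mu0 sc; set ub := _ *: _.
have tR : 0 < t%:R :> R by rewrite ltr0n.
have E : \sum_(k < t) u k = t%:R *: ub by rewrite scalerA divff ?gt_eqF// scale1r.
rewrite mulrC ler_pdivlMr//.
have H (a : V) : \sum_(k < t) dotv a (u k) = t%:R * dotv a ub.
  by rewrite -dotv_sumr E dotvZr.
have C (c : R) : \sum_(k < t) c = t%:R * c by rewrite sumr_const card_ord mulr_natl.
(* Jensen from the tangent at the mean [ub]: the linear terms of these divergences sum to zero,
   which leaves t f(ub) <= sum of f(u_k). *)
have : 0 <= \sum_(k < t) bregman f gf (u k) ub.
  by apply: sumr_ge0 => k _; exact: bregman_ge0 sc.
rewrite /bregman.
under eq_bigr do rewrite dotvDr dotvNr.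
under [X in _ -> _ <= X]eq_bigr do rewrite dotvDr dotvNr.
rewrite !big_split/= !sumrN !big_split/= !H !sumrN !C.
rewrite !dotvE; lra.
Qed.

End Deterministic.

(** * Measurability of continuous and nonexpansive images *)

Section Measurability.
Set Implicit Arguments.
Unset Strict Implicit.
Unset Printing Implicit Defensive.
Context {R : realType} {dT : measure_display} {T : measurableType dT}.

(* [{X > c}] is the union of the rational boxes in [A]-space on which [X > c]. *)
Lemma measurable_fun_factor (I : finType) (A : T -> I -> R) (X : T -> R) :
  (forall i, measurable_fun setT (A ^~ i)) ->
  (forall w (e : R), 0 < e -> exists2 de : R, 0 < de &
     forall w', (forall i, `|A w i - A w' i| < de) -> `|X w - X w'| < e) ->
  measurable_fun setT X.
Proof.
move=> mA cX; apply: (measurability _ (RGenOInfty.measurableE R)).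
move=> _ [_ [c ->] <-]; rewrite setTI.
pose box (q : {ffun I -> rat} * rat) : set T :=
  [set w | forall i, `|A w i - ratr (q.1 i)| < ratr q.2].
have mbox q : measurable (box q).
  rewrite (_ : box q = \bigcap_(i in setT) (A ^~ i @^-1`
      `]ratr (q.1 i) - ratr q.2, ratr (q.1 i) + ratr q.2[)); last first.
    apply/seteqP; split => w /= H i; last by have := H i Logic.I; rewrite /= in_itv/= -ltr_distl.
    by move=> _; rewrite /= in_itv/= -ltr_distl.
  apply: fin_bigcap_measurable => // i _.
  by rewrite -[X in measurable X]setTI; apply: mA.
rewrite (_ : _ @^-1` _ = \bigcup_q
    (if `[< box q `<=` [set w | c < X w] >] then box q else set0)).
  apply: countable_bigcupT_measurable; first exact: countableP.
  by move=> q; case: ifP.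
apply/seteqP; split => [w /=|w [q _]]; last first.
  by rewrite /= in_itv/= andbT; case: ifP => // /asboolP; apply.
rewrite in_itv/= andbT => cXw.
have [de de0 Hde] := cX w (X w - c) ltac:(by rewrite subr_gt0).
(* A box whose centre is within [r] of [A w] and whose half-width is [r] contains only points within
   2r < [de] of [A w]. *)
have [r] : exists r : rat, ratr r \in `]0, de / 2[%R.
  by apply: rat_in_itvoo; rewrite divr_gt0.
rewrite in_itv/= => /andP[r0 rde].
have /choice[q Hq] : forall i, exists q : rat, `|A w i - ratr q| < ratr r.
  move=> i; have [q] : exists q : rat, ratr q \in `]A w i - ratr r, A w i + ratr r[%R.
    by apply: rat_in_itvoo; lra.
  by rewrite in_itv/= => /andP[? ?]; exists q; rewrite ltr_norml; apply/andP; split; lra.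
exists ([ffun i => q i], r) => //.
case: ifPn => [_ i /=|/asboolPn[]]; first by rewrite ffunE.
move=> w' /= Hw'; suff /Hde : forall i, `|A w i - A w' i| < de.
  by rewrite ltr_norml => /andP[_]; lra.
move=> i; have := Hw' i; have := Hq i; rewrite ffunE !ltr_norml.
by move=> /andP[? ?] /andP[? ?]; apply/andP; split; lra.
Qed.

Lemma measurable_fun_select (m : nat) (J : T -> 'I_m) (X : 'I_m -> T -> R) :
  (forall k, measurable [set w | J w = k]) ->
  (forall k, measurable_fun setT (X k)) ->
  measurable_fun setT (fun w => X (J w) w).
Proof.
move=> mJ mX _ B mB; rewrite setTI.
rewrite (_ : _ @^-1` _ = \bigcup_(k in setT) ([set w | J w = k] `&` X k @^-1` B)).
  apply: fin_bigcup_measurable => // k _; apply: measurableI => //.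
  by rewrite -[X in measurable X]setTI; exact: mX.
by apply/seteqP; split => [w /= XB|w [k _ /= [<-]//]]; exists (J w).
Qed.

Context {d : nat}.
Local Notation V := 'rV[R]_d.

Definition measurable_vec (X : T -> V) :=
  forall i, measurable_fun setT (fun w => X w ord0 i).

Lemma measurable_vec_cst (u : V) : measurable_vec (cst u).
Proof. by move=> i; exact: measurable_cst. Qed.

Lemma measurable_vecD X Y : measurable_vec X -> measurable_vec Y ->
  measurable_vec (fun w => X w + Y w).
Proof.
move=> mX mY i; under eq_fun do rewrite mxE.
exact: measurable_funD.
Qed.

Lemma measurable_vecZ X c : measurable_vec X -> measurable_vec (fun w => c *: X w).
Proof.
move=> mX i; under eq_fun do rewrite mxE.
exact: measurable_funM.
Qed.

Lemma measurable_vecB X Y : measurable_vec X -> measurable_vec Y ->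
  measurable_vec (fun w => X w - Y w).
Proof.
move=> mX mY; under eq_fun do rewrite -scaleN1r.
by apply: measurable_vecD => //; exact: measurable_vecZ.
Qed.

Lemma measurable_vec_sum (I : Type) (s : seq I) (X : I -> T -> V) :
  (forall k, measurable_vec (X k)) -> measurable_vec (fun w => \sum_(k <- s) X k w).
Proof.
move=> mX i; under eq_fun do rewrite summxE.
by apply: measurable_sum => k; exact: mX.
Qed.

Lemma measurable_fun_sqnorm X : measurable_vec X ->
  measurable_fun setT (fun w => sqnorm (X w)).
Proof. by move=> mX; apply: measurable_sum => i; exact: measurable_funM. Qed.

Lemma measurable_fun_dotv X a : measurable_vec X ->
  measurable_fun setT (fun w => dotv a (X w)).
Proof. by move=> mX; apply: measurable_sum => i; exact: measurable_funM. Qed.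

Lemma measurable_fun_comp_continuous (f : V -> R) X : continuous f ->
  measurable_vec X -> measurable_fun setT (fun w => f (X w)).
Proof.
move=> cf mX; apply: (@measurable_fun_factor _ (fun w i => X w ord0 i)) => // w e e0.
have /nbhs_ballP[de /= de0 Hde] : \forall u \near X w, `|f (X w) - f u| < e.
  by move/cvgrPdist_lt : (cf (X w)); exact.
by exists de => // w' Hw'; apply: Hde; split => // i j; rewrite ord1; exact: Hw'.
Qed.

(** The sum is at most d / (d + 1)^2 times e^2; using d + 1 instead of d also covers d = 0. *)
Lemma sqnorm_lt (u : V) (e : R) : 0 < e -> (forall i, `|u ord0 i| < e / d.+1%:R) ->
  sqnorm u < e ^+ 2.
Proof.
move=> e0 ue; have d0 : 0 < d.+1%:R :> R by [].
apply: (@le_lt_trans _ _ (\sum_(i < d) (e / d.+1%:R) ^+ 2)).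
  apply: ler_sum => i _; rewrite -expr2 -[leLHS]real_normK ?num_real//.
  by rewrite ler_sqr ?nnegrE// ?ltW// divr_gt0.
rewrite sumr_const card_ord -[_ *+ d]mulr_natl exprMn exprVn mulrCA gtr_pMr ?exprn_gt0//.
rewrite ltr_pdivrMr ?exprn_gt0// mul1r -natrX ltr_nat.
by rewrite (@leq_trans (d.+1))// leq_pmull.
Qed.

(** Meant for a prox whose function depends on the sampled index: once [J] is fixed, [X] is a
    1-Lipschitz function of [A]. Adjoining the indicators of [J = k] to the coordinates of [A] makes
    [X] a continuous function of finitely many measurable reals. *)
Lemma measurable_vec_nonexpansive (m : nat) (J : T -> 'I_m) (A X : T -> V) :
  (forall k, measurable [set w | J w = k]) -> measurable_vec A ->
  (forall w w', J w = J w' -> sqnorm (X w - X w') <= sqnorm (A w - A w')) ->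
  measurable_vec X.
Proof.
move=> mJ mA AX i.
pose B w (j : 'I_d + 'I_m) : R :=
  match j with inl l => A w ord0 l | inr k => (J w == k)%:R end.
apply: (@measurable_fun_factor _ B) => [[l|k]|w e e0].
- exact: mA.
- by apply: (@measurable_fun_select _ J (fun j _ => (j == k)%:R)) => //.
(* Indicators closer than 1 are equal, so the bound 1 forces [J w = J w']. *)
exists (Num.min 1 (e / d.+1%:R)); first by rewrite lt_min ltr01 divr_gt0.
move=> w' Hw'.
have JJ : J w = J w'.
  have := Hw' (inr (J w)); rewrite /= eqxx lt_min => /andP[+ _].
  by case: eqP => [->//|_]; rewrite subr0 normr1 ltxx.
rewrite -ltr_sqr ?nnegrE ?normr_ge0 ?(ltW e0)// real_normK ?num_real//.
apply: (@le_lt_trans _ _ (sqnorm (X w - X w'))).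
  by apply: le_trans (sqr_coord_le_sqnorm _ i); rewrite !mxE.
apply: (le_lt_trans (AX _ _ JJ)); apply: sqnorm_lt => // l.
by have := Hw' (inl l); rewrite lt_min !mxE => /andP[].
Qed.

Lemma measurable_fun_bregman f gf (b : V) X : is_gradient f gf ->
  measurable_vec X -> measurable_fun setT (fun w => bregman f gf (X w) b).
Proof.
move=> Hf mX; apply: measurable_funB.
  apply: measurable_funB => //; apply: measurable_fun_comp_continuous => // u.
  exact/differentiable_continuous/(Hf u).1.
apply: measurable_fun_dotv; apply: measurable_vecB => //.
Qed.

End Measurability.

(** * Averaging over an index independent of the past *)

Section Independence.
Set Implicit Arguments.
Unset Strict Implicit.
Unset Printing Implicit Defensive.
Context {R : realType} {dT : measure_display} {T : measurableType dT}.
Variable P : probability T R.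
Variable G : set (set T).
Hypothesis sG : sigma_algebra setT G.
Hypothesis Gm : G `<=` measurable.
Local Notation TG := (g_sigma_algebraType G).

Lemma measurable_fun_sub_sigma (X : TG -> R) :
  measurable_fun setT X -> measurable_fun setT (X : T -> R).
Proof.
move=> mX _ B mB; apply: Gm.
by rewrite -(measurable_g_measurableTypeE sG); exact: mX.
Qed.

Local Open Scope ereal_scope.

(* Both sides are integrals over [TG], of [P] restricted to [E] and of [p P]. *)
Lemma integral_indep E (p : R) (X : TG -> R) : measurable E -> (0 <= p)%R ->
  (forall A, G A -> P (A `&` E) = p%:E * P A) ->
  measurable_fun setT X -> (forall w, 0 <= X w)%R ->
  \int[P]_(w in E) (X w)%:E = p%:E * \int[P]_w (X w)%:E.
Proof.
move=> mE p0 indep mX X0.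
(* The identity is measurable since [G] consists of measurable sets; pushing [P] along it restricts
   [P] to [G]. *)
pose phi : T -> TG := id.
have mphi : measurable_fun setT phi.
  move=> _ B; rewrite (measurable_g_measurableTypeE sG) setTI => GB.
  exact: Gm.
have mXT : measurable_fun setT (EFin \o (X : T -> R)).
  by apply/measurable_EFinP; exact: measurable_fun_sub_sigma.
have mXG : measurable_fun setT (EFin \o X) by apply/measurable_EFinP.
rewrite -(@ge0_integral_pushforward _ _ _ _ _ phi mphi P setT (EFin \o X))//; last first.
  by move=> w _; rewrite lee_fin.
rewrite -(@ge0_integral_mscale _ _ _ _ _ measurableT (NngNum p0))//; last first.
  by move=> w _; rewrite lee_fin.
transitivity (\int[pushforward (mrestr P mE) phi]_w (X w)%:E); last first.
  apply: eq_measure_integral => A; rewrite (measurable_g_measurableTypeE sG) => GA _.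
  exact: indep.
rewrite ge0_integral_pushforward//; last by move=> w _; rewrite lee_fin.
rewrite preimage_setT -(setUv E) ge0_integral_setU//=.
- rewrite [X in _ + X](_ : _ = 0) ?adde0; last first.
    apply: null_set_integral => //.
    + exact: measurableC.
    + exact: measurable_funTS.
    + by rewrite /= /mrestr setICl measure0.
  apply: eq_measure_integral => A mA AE; rewrite /= /mrestr.
  by rewrite (setIidl AE).
- exact: measurableC.
- by rewrite setUv.
- by move=> w _; rewrite lee_fin.
- by apply/disj_setPS; rewrite setICr.
Qed.

(** This replaces a conditional expectation: E X <= E U_J = sum_k E[1_{J=k} U_k] = sum_k p_k E U_k
    <= E Z. Only the [U k] must be measurable for the past, and nonnegativity makes integrability
    unnecessary. *)
Lemma integral_select_le m (J : T -> 'I_m) (p : 'I_m -> R) (U : 'I_m -> TG -> R)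
    (X Z : T -> R) :
  (forall k, measurable [set w | J w = k]) -> (forall k, 0 <= p k)%R ->
  (forall k A, G A -> P (A `&` [set w | J w = k]) = (p k)%:E * P A) ->
  (forall k, measurable_fun setT (U k)) -> (forall k w, 0 <= U k w)%R ->
  measurable_fun setT X -> (forall w, 0 <= X w)%R ->
  measurable_fun setT Z ->
  (forall w, X w <= U (J w) w)%R ->
  (forall w, \sum_k p k * U k w <= Z w)%R ->
  \int[P]_w (X w)%:E <= \int[P]_w (Z w)%:E.
Proof.
move=> mJ p0 indep mU U0 mX X0 mZ XU UZ.
have mUT k : measurable_fun setT (U k : T -> R) by exact: measurable_fun_sub_sigma.
have pU0 k w : (0 <= p k * U k w)%R by rewrite mulr_ge0.
apply: (@le_trans _ _ (\int[P]_w (U (J w) w)%:E)).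
  apply: ge0_le_integral => //=.
  - by move=> w _; rewrite lee_fin.
  - exact/measurable_EFinP.
  - by apply/measurable_EFinP; exact: measurable_fun_select.
  - by move=> w _; rewrite lee_fin.
apply: (@le_trans _ _ (\int[P]_w (\sum_k p k * U k w)%:E)); last first.
  apply: ge0_le_integral => //=.
  - by move=> w _; rewrite lee_fin sumr_ge0.
  - apply/measurable_EFinP; apply: measurable_sum => k.
    exact: measurable_funM.
  - exact/measurable_EFinP.
  - by move=> w _; rewrite lee_fin.
have -> : \int[P]_w (\sum_k p k * U k w)%:E = \sum_k (p k)%:E * \int[P]_w (U k w)%:E.
  under eq_integral do rewrite -sumEFin.
  rewrite ge0_integral_sum//.
  - apply: eq_bigr => k _; under eq_integral do rewrite EFinM.
    rewrite ge0_integralZl ?lee_fin//; first exact/measurable_EFinP.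
    by move=> w _; rewrite lee_fin.
  - by move=> k; apply/measurable_EFinP; exact: measurable_funM.
  - by move=> k w _; rewrite lee_fin.
under [leRHS]eq_bigr => k _ do rewrite -(integral_indep (mJ k) (p0 k) (indep k) (mU k) (U0 k)).
under [leRHS]eq_bigr => k _ do rewrite integral_mkcond.
(* Pointwise, only the term k = [J w] of the sum of restrictions survives. *)
rewrite -ge0_integral_sum//.
- rewrite le_eqVlt; apply/orP; left; apply/eqP; apply: eq_integral => w _.
  rewrite (bigD1 (J w))//= big1 ?adde0 ?patchE ?mem_set//.
  by move=> k kJ; rewrite patchE memNset//= => Jk; rewrite Jk eqxx in kJ.
- move=> k; apply/(measurable_restrictT _ (mJ k)); apply: measurable_funTS.
  exact/measurable_EFinP.
- by move=> k w _; apply: erestrict_ge0 => u _; rewrite lee_fin.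
Qed.

End Independence.

(** * The exact mean of one sampled step *)

Section Step.
Set Implicit Arguments.
Unset Strict Implicit.
Unset Printing Implicit Defensive.
Context {R : realType} {d m : nat}.
Local Notation V := 'rV[R]_d.
Variables (eta : R) (p : 'I_m -> R).
Hypotheses (eta0 : 0 < eta) (p0 : forall k, 0 < p k) (p1 : \sum_k p k = 1).

Lemma eta_j_gt0 k : 0 < eta_j eta p k.
Proof. by rewrite divr_gt0// mulr_gt0// ltr0n; case: m k => [[]|]. Qed.

Lemma ymeanB (y s : 'I_m -> V) : ymean y - ymean s = ymean (fun k => y k - s k).
Proof. by rewrite /ymean -scalerBr -sumrB. Qed.

(** The square eta_k^2 |s_k|^2 completes the partial sum to the full one, and p_k eta_k = eta / m
    turns the cross terms into one with the mean. *)
Lemma sampled_step_mean (e : V) (s : 'I_m -> V) :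
  \sum_k p k * (sqnorm (e + eta_j eta p k *: s k) +
      \sum_(i | i != k) (eta_j eta p i) ^+ 2 * sqnorm (s i)) =
  sqnorm e + 2 * eta * dotv e (ymean s) +
    \sum_k (eta_j eta p k) ^+ 2 * sqnorm (s k).
Proof.
pose S := \sum_k (eta_j eta p k) ^+ 2 * sqnorm (s k).
have E k : p k * (sqnorm (e + eta_j eta p k *: s k) +
    \sum_(i | i != k) (eta_j eta p i) ^+ 2 * sqnorm (s i)) =
    p k * (sqnorm e + S) + 2 * eta * m%:R^-1 * dotv e (s k).
  rewrite [S](bigD1 k)//= /sqnorm !(@dotvE R d) (dotvC (s k) e).
  move: (\sum_(i | _) _) => S'; rewrite /eta_j.
  have m0 : m%:R != 0 :> R by rewrite pnatr_eq0; case: m k => [[]|].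
  by field; rewrite m0 gt_eqF.
under eq_bigr do rewrite E.
rewrite big_split/= -mulr_suml p1 mul1r -mulr_sumr -dotv_sumr /ymean dotvZr.
by rewrite -/S; ring.
Qed.

End Step.

(** Stated in [\bar R] because no integrability is assumed: the real bound [l] keeps [a n], [Q n]
    and the partial sum finite, and [B n = +oo] would make the right-hand side of the descent
    inequality [-oo], below a nonnegative left-hand side. *)
Lemma telescoped_descent {R : realType} (a Q W B : nat -> \bar R) (M : nat -> R) (c l : R) :
  0 < c ->
  (forall n, 0 <= a n)%E -> (forall n, 0 <= Q n)%E -> (forall n, 0 <= W n)%E ->
  (forall n, 0 <= B n)%E -> (forall n, 0 <= M n) ->
  (a 0%N + Q 0%N + (M 0%N)%:E <= l%:E)%E ->
  (forall n, a n.+1 + Q n.+1 <= W n + Q n)%E ->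
  (forall n, W n + (M n.+1)%:E <= a n - c%:E * B n + (M n)%:E)%E ->
  forall n, (a n + Q n + (M n)%:E + c%:E * \sum_(k < n) B k <= l%:E)%E.
Proof.
move=> c0 a0 Q0 W0 B0 M0 H0 H1 H2; elim => [|n IH].
  by rewrite big_ord0 mule0 adde0.
rewrite big_ord_recr/=.
have S0 : (0 <= \sum_(k < n) B k)%E by apply: sume_ge0.
move: IH (H1 n) (H2 n) (a0 n) (Q0 n) (W0 n) (B0 n) S0 (a0 n.+1) (Q0 n.+1) (M0 n) (M0 n.+1).
move: (\sum_(k < n) B k)%E (a n) (Q n) (W n) (B n) (a n.+1) (Q n.+1) (M n) (M n.+1).
move=> [s||]// [u||]// [q||]// [w||]// [b||]// [u'||]// [q'||]// M1 M2 /=;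
  rewrite ?gt0_muley ?lte_fin//= -?EFinM -?EFinN -?EFinD ?lee_fin//; lra.
Qed.

(** * Adaptedness, one-step descent and the final rate *)

Theorem theorem1 (R : realType) (d m : nat)
  (f : 'rV[R]_d -> R) (gf : 'rV[R]_d -> 'rV[R]_d)
  (g : 'I_m -> 'rV[R]_d -> \bar R) (Rr : 'rV[R]_d -> \bar R)
  (L mu : R)
  (xs : 'rV[R]_d) (ys : 'I_m -> 'rV[R]_d) (rs : 'rV[R]_d)
  (eta : R) (p : 'I_m -> R)
  (dT : measure_display) (T : measurableType dT) (P : probability T R)
  (F : nat -> set (set T))
  (x v z : nat -> T -> 'rV[R]_d) (y : nat -> 'I_m -> T -> 'rV[R]_d)
  (J : nat -> T -> 'I_m)
  (x0 : 'rV[R]_d) (y0 : 'I_m -> 'rV[R]_d)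
  (eta0 om : R) (M : nat -> R) :
  (* the problem *)
  is_gradient f gf -> convex_real f ->
  (forall j, proper_fun (g j) /\ closed_fun (g j) /\ convex_efun (g j)) ->
  proper_fun Rr -> closed_fun Rr -> convex_efun Rr ->
  L_smooth f gf L -> 0 <= mu -> strongly_convex f gf mu ->
  (* standing optimality assumption *)
  (forall u, (Fobj f g Rr xs <= Fobj f g Rr u)%E) ->
  (forall j, subgrad (g j) xs (ys j)) -> subgrad Rr xs rs ->
  gf xs + ymean ys + rs = 0 ->
  (* parameters of the method *)
  0 < eta -> (forall j, 0 < p j) -> \sum_(j < m) p j = 1 ->
  (* filtration (the past) *)
  (forall t, sigma_algebra setT (F t)) ->
  (forall t, F t `<=` measurable) ->
  (forall t, F t `<=` F t.+1) ->
  (forall t (i : 'I_d), meas_wrt (F t) (fun w => v t w ord0 i)) ->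
  (forall t k, F t.+1 [set w | J t w = k]) ->
  (* index j_t drawn with Pr(j = k) = p_k independently of the past *)
  (forall t k A, F t A ->
     P (A `&` [set w | J t w = k]) = ((p k)%:E * P A)%E) ->
  (* the Stochastic Decoupling Method *)
  (forall w, x 0 w = x0 /\ forall k, y 0 k w = y0 k) ->
  (forall t w, is_prox Rr eta (x t w - eta *: v t w - eta *: ymean (y t ^~ w))
                 (z t w)) ->
  (forall t w, let j := J t w in
     is_prox (g j) (eta_j eta p j) (z t w + eta_j eta p j *: y t j w)
             (x t.+1 w)
     /\ y t.+1 j w = y t j w + (eta_j eta p j)^-1 *: (z t w - x t.+1 w)
     /\ forall k, k != j -> y t.+1 k w = y t k w) ->
  (* gradient-estimator condition *)
  0 < eta0 -> 0 < om -> (forall t, 0 <= M t) -> eta <= eta0 ->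
  (forall t,
     (\int[P]_w (sqnorm ((x t w - eta *: v t w) - (xs - eta *: gf xs)))%:E
        + (M t.+1)%:E
      <= \int[P]_w (sqnorm (x t w - xs))%:E
         - (om * eta)%:E * \int[P]_w (bregman f gf (x t w) xs)%:E
         + (M t)%:E)%E) ->
  ((forall t, M t = 0) \/
   exists2 rho : R, 0 < rho & forall t,
     (\int[P]_w (sqnorm ((x t w - eta *: v t w) - (xs - eta *: gf xs)))%:E
        + (M t.+1)%:E
      <= (1 - om * eta * mu)%:E * \int[P]_w (sqnorm (x t w - xs))%:E
         + ((1 - rho) * M t)%:E)%E) ->
  (* conclusion *)
  forall t : nat, (0 < t)%N ->
    (\int[P]_w (bregman f gf (t%:R^-1 *: \sum_(k < t) x k w) xs)%:E
     <= ((om * eta * t%:R)^-1 *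
          (sqnorm (x0 - xs) + M 0%N
           + \sum_(k < m) (eta_j eta p k) ^+ 2 * sqnorm (y0 k - ys k)))%:E)%E.
Proof.
move=> Hgrad _ Hg pR _ cR _ mu0 sc _ subg subR Hopt eta_gt0 p0 p1 sF FT FS mv mJ indep
  Hinit Hz Hstep _ om0 M0 _ Hest _ t t0.
have etaj0 k : 0 < eta_j eta p k by exact: eta_j_gt0.
have mJT s k : measurable [set w | J s w = k] by apply: (FT s.+1).
pose TF s := g_sigma_algebraType (F s).
have FE s : measurable = F s :> set (set (TF s)) by exact: measurable_g_measurableTypeE.
have measS s (X : T -> 'rV[R]_d) : measurable_vec (X : TF s -> _) ->
    measurable_vec (X : TF s.+1 -> _).
  move=> mX i _ B mB; have /(_ measurableT B mB) := mX i.
  by rewrite !FE; exact: FS.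
have mvF s : measurable_vec (v s : TF s -> _).
  by move=> i _ B mB; rewrite setTI FE; exact: mv.
have measZ s : measurable_vec (x s : TF s -> _) ->
    (forall k, measurable_vec (y s k : TF s -> _)) -> measurable_vec (z s : TF s -> _).
  (* The prox of [Rr] involves no sampled index, so a constant index in ['I_1] is supplied. *)
  move=> mx my; apply: (@measurable_vec_nonexpansive _ _ (TF s) _ 1 (fun=> ord0)
    (fun w => x s w - eta *: v s w - eta *: ymean (y s ^~ w))).
  - by move=> k; rewrite (ord1 k) (_ : mkset _ = setT)//; apply/seteqP; split.
  - apply: measurable_vecB; first by apply: measurable_vecB => //; exact: measurable_vecZ.
    by apply/measurable_vecZ/measurable_vecZ; exact: measurable_vec_sum.
  - by move=> w w' _; apply: prox_nonexpansive (Hz s w) (Hz s w').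
have meas s : measurable_vec (x s : TF s -> _) /\
    (forall k, measurable_vec (y s k : TF s -> _)).
  (* [J s] is known only at time [s.+1], so the data of step [s] are first lifted to [F s.+1]. *)
  elim: s => [|s [mx my]].
    split => [|k].
      have -> : x 0%N = cst x0 by apply/funext => w; exact: (Hinit w).1.
      exact: measurable_vec_cst.
    have -> : y 0%N k = cst (y0 k) by apply/funext => w; exact: (Hinit w).2.
    exact: measurable_vec_cst.
  have mz := measS _ _ (measZ s mx my).
  have {}my k := measS _ _ (my k).
  have mJF k : measurable ([set w | J s w = k] : set (TF s.+1)) by rewrite FE.
  have mx' : measurable_vec (x s.+1 : TF s.+1 -> _).
    apply: (@measurable_vec_nonexpansive _ _ (TF s.+1) _ m (J s)
      (fun w => z s w + eta_j eta p (J s w) *: y s (J s w) w)) => //.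
      move=> i.
      apply: (@measurable_fun_select _ _ (TF s.+1) _ (J s)
        (fun k w => (z s w + eta_j eta p k *: y s k w) ord0 i)) => // k.
      by move: i; apply: measurable_vecD => //; exact: measurable_vecZ.
    move=> w w' JJ.
    have [h1 _] := Hstep s w; have [h2 _] := Hstep s w'.
    rewrite -JJ in h2. rewrite -?JJ.
    by have [pg [_ cg]] := Hg (J s w); apply: prox_nonexpansive h1 h2.
  split => // k i.
  rewrite (_ : (fun w => _) = fun w => (if J s w == k
      then y s k w + (eta_j eta p k)^-1 *: (z s w - x s.+1 w) else y s k w) ord0 i).
    apply: (@measurable_fun_select _ _ (TF s.+1) _ (J s) (fun j w => (if j == k
      then y s k w + (eta_j eta p k)^-1 *: (z s w - x s.+1 w) else y s k w) ord0 i)) => // j.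
    case: (j == k); last exact: my.
    move: i; apply: measurable_vecD => //; apply: measurable_vecZ.
    exact: measurable_vecB.
  apply/funext => w; have [_ [h1 h2]] := Hstep s w.
  by case: eqP => [<-|/eqP Jk]; rewrite ?h1// h2// eq_sym.
have measT s (X : T -> 'rV[R]_d) : measurable_vec (X : TF s -> _) -> measurable_vec X.
  by move=> mX i; exact: (measurable_fun_sub_sigma (sF s) (FT s) (mX i)).
have mxT s := measT s _ (meas s).1.
have myT s k := measT s _ ((meas s).2 k).
have mzF s := measZ s (meas s).1 (meas s).2.
pose Q s w := \sum_k (eta_j eta p k) ^+ 2 * sqnorm (y s k w - ys k).
have Q0 s w : 0 <= Q s w by apply: sumr_ge0 => k _; rewrite mulr_ge0 ?sqr_ge0 ?sqnorm_ge0.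
have mQ s : measurable_fun setT (Q s).
  apply: measurable_sum => k; apply: measurable_funM => //.
  by apply: measurable_fun_sqnorm; exact: measurable_vecB.
have mxs s : measurable_fun setT (fun w => sqnorm (x s w - xs)).
  by apply: measurable_fun_sqnorm; exact: measurable_vecB.
pose ws s w := (x s w - eta *: v s w) - (xs - eta *: gf xs).
have mws s : measurable_fun setT (fun w => sqnorm (ws s w)).
  apply: measurable_fun_sqnorm; apply: measurable_vecB => //.
  by apply: measurable_vecB => //; apply: measurable_vecZ; exact: (measT s).
have intD (X Y : T -> R) : measurable_fun setT X -> measurable_fun setT Y ->
    (forall w, 0 <= X w) -> (forall w, 0 <= Y w) ->
    (\int[P]_w (X w + Y w)%:E = \int[P]_w (X w)%:E + \int[P]_w (Y w)%:E)%E.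
  move=> mX mY X0 Y0; under eq_integral do rewrite EFinD.
  by rewrite ge0_integralD//; try (by move=> w _; rewrite lee_fin);
    exact/measurable_EFinP.
have onestep s : (\int[P]_w (sqnorm (x s.+1 w - xs))%:E + \int[P]_w (Q s.+1 w)%:E <=
    \int[P]_w (sqnorm (ws s w))%:E + \int[P]_w (Q s w)%:E)%E.
  rewrite -!intD//; try (by move=> w; exact: sqnorm_ge0).
  (* The bound on the new potential if index [k] is drawn; it involves only [z s] and [y s], hence
     is measurable for [F s]. *)
  pose U k w := sqnorm (z s w - xs + eta_j eta p k *: (y s k w - ys k)) +
    \sum_(i | i != k) (eta_j eta p i) ^+ 2 * sqnorm (y s i w - ys i).
  apply: (integral_select_le (sF s) (FT s) (p := p) (J := J s) (U := U)) => //.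
  - by move=> k; exact: ltW.
  - move=> k A GA; exact: indep.
  - move=> k; apply: measurable_funD.
      apply: measurable_fun_sqnorm; apply: measurable_vecD.
        exact: measurable_vecB.
      by apply: measurable_vecZ; apply: measurable_vecB => //; exact: (meas s).2.
    rewrite (_ : (fun w => _) = fun w : TF s => \sum_(i <- enum [pred i | i != k])
      (eta_j eta p i) ^+ 2 * sqnorm (y s i w - ys i)); last first.
      by apply/funext => w; rewrite big_enum.
    apply: measurable_sum => i; apply: measurable_funM => //.
    by apply: measurable_fun_sqnorm; apply: measurable_vecB => //; exact: (meas s).2.
  - move=> k w; rewrite addr_ge0 ?sqnorm_ge0// sumr_ge0// => i _.
    by rewrite mulr_ge0 ?sqr_ge0 ?sqnorm_ge0.
  - exact: measurable_funD.
  - by move=> w; rewrite addr_ge0 ?sqnorm_ge0.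
  - exact: measurable_funD.
  - move=> w; have [h1 [h2 h3]] := Hstep s w; rewrite /U /Q.
    have [pg [_ cg]] := Hg (J s w).
    rewrite (bigD1 (J s w))//= addrA lerD//; last first.
      by rewrite ler_sum// => i iJ; rewrite h3.
    have := prox_step_le (etaj0 _) pg cg h1 (subg _).
    set e := eta_j eta p (J s w).
    (* By the dual update, the residual of the prox step is [e] times the new dual error. *)
    rewrite (_ : _ - _ - e *: ys _ = e *: (y s.+1 (J s w) w - ys (J s w))); last first.
      rewrite h2 scalerBr scalerDr scalerA divff ?gt_eqF// ?etaj0// scale1r.
      by apply/rowP => i; rewrite !mxE; ring.
    rewrite [sqnorm (e *: _)]/sqnorm dotvZl dotvZr mulrA -expr2.
    rewrite (_ : z s w + _ - _ = z s w - xs + e *: (y s (J s w) w - ys (J s w)))//.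
    by apply/rowP => i; rewrite !mxE; ring.
  - move=> w; rewrite /U sampled_step_mean// lerD2r -ymeanB /ws.
    (* Both points are shifted by [eta *: ymean ys]; optimality turns the shifted w* into
       [xs + eta *: rs], a point whose prox is [xs]. *)
    rewrite (_ : x s w - _ - _ = (x s w - eta *: v s w - eta *: ymean ys) - (xs + eta *: rs)).
      apply: (prox_step_decoupled eta_gt0 pR cR _ subR) => //.
      rewrite (_ : _ - _ = x s w - eta *: v s w - eta *: ymean (y s ^~ w)) ?Hz//.
      by apply/rowP => i; rewrite !mxE; ring.
    have -> : rs = - gf xs - ymean ys.
      apply: (addrI (gf xs + ymean ys)); rewrite Hopt.
      by apply/rowP => i; rewrite !mxE; ring.
    by apply/rowP => i; rewrite !mxE; ring.
have B0 s w : 0 <= bregman f gf (x s w) xs by exact: bregman_ge0 sc.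
have mB s : measurable_fun setT (fun w => bregman f gf (x s w) xs).
  exact: measurable_fun_bregman.
have c0 : 0 < om * eta by rewrite mulr_gt0.
have int0 (X : T -> R) : (forall w, 0 <= X w) -> (0 <= \int[P]_w (X w)%:E)%E.
  by move=> X0; apply: integral_ge0 => w _; rewrite lee_fin.
have := telescoped_descent (l := sqnorm (x0 - xs) + M 0%N +
  \sum_(k < m) (eta_j eta p k) ^+ 2 * sqnorm (y0 k - ys k)) c0
  (fun n => int0 _ (fun w => sqnorm_ge0 (x n w - xs))) (fun n => int0 _ (Q0 n))
  (fun n => int0 _ (fun w => sqnorm_ge0 (ws n w)))
  (fun n => int0 _ (B0 n)) M0 _ onestep Hest t.
rewrite -intD//; last by move=> w; exact: sqnorm_ge0.
(* The starting point is deterministic, so the initial expectation is a constant. *)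
have -> : (\int[P]_w (sqnorm (x 0%N w - xs) + Q 0%N w)%:E)%E =
    (sqnorm (x0 - xs) + \sum_(k < m) (eta_j eta p k) ^+ 2 * sqnorm (y0 k - ys k))%:E.
  rewrite (eq_integral (cst (sqnorm (x0 - xs) +
    \sum_(k < m) (eta_j eta p k) ^+ 2 * sqnorm (y0 k - ys k))%:E)).
    by rewrite integral_cst//= probability_setT mule1.
  move=> w _; rewrite /Q (Hinit w).1 /=; congr (_ + _)%:E.
  by apply: eq_bigr => k _; rewrite (Hinit w).2.
rewrite -EFinD addrAC => /(_ (lexx _)).
set l := (_ + _ + \sum_(_ < _) _) => Hl.
have tR : 0 < t%:R :> R by rewrite ltr0n.
apply: (@le_trans _ _ (\int[P]_w (t%:R^-1 * \sum_(k < t) bregman f gf (x k w) xs)%:E)%E).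
  apply: ge0_le_integral => //=.
  - by move=> w _; rewrite lee_fin; exact: bregman_ge0 sc.
  - apply/measurable_EFinP; apply: measurable_fun_bregman => //.
    by apply: measurable_vecZ; apply: measurable_vec_sum.
  - apply/measurable_EFinP; apply: measurable_funM => //.
    exact: measurable_sum.
  - by move=> w _; rewrite lee_fin; exact: (@bregman_mean_le _ _ f gf mu xs t (x ^~ w)).
under eq_integral do rewrite EFinM -sumEFin.
rewrite ge0_integralZl ?lee_fin ?invr_ge0//; last 2 first.
- under eq_fun do rewrite sumEFin.
  by apply/measurable_EFinP; exact: measurable_sum.
- by move=> w _; apply: sume_ge0 => k _; rewrite lee_fin.
rewrite ge0_integral_sum//; last 2 first.
- by move=> k; exact/measurable_EFinP.
- by move=> k w _; rewrite lee_fin.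
have -> : (om * eta * t%:R)^-1 * l = t%:R^-1 * ((om * eta)^-1 * l).
  by rewrite invfM mulrA (mulrC t%:R^-1).
rewrite EFinM lee_pmul2l ?lte_fin ?invr_gt0// (mulrC _ l) EFinM lee_pdivlMr// muleC.
apply: le_trans Hl.
(* The potential left at time [t] is nonnegative and is dropped. *)
rewrite leeDr//; apply: adde_ge0; last by rewrite lee_fin.
by apply: adde_ge0; apply: int0 => // w; exact: sqnorm_ge0.
Qed.
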